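(* Fix the data $d,\mu_1,\mu_2,h_0,T,L,f,u_0$ as in the context. There exists a constant $C>0$, independent of $n$, $\Delta t$ and $\Delta\tilde z$, such that for all integers $M\ge2$, $N\ge1$ with $\Delta t=T/N<\frac1{2L}$, the solution $\{\tilde W_j^n\}$ of the finite difference scheme (S2) described in the context satisfies $$\|\tilde W^n\|_d\le C\,\|\tilde W^0\|_d,\qquad 1\le n\le N.$$
   Context: Data: $d,\mu_1,\mu_2,h_0,T,L$ are positive constants; $f:\mathbb{R}\to\mathbb{R}$ is differentiable and satisfies $-Lu\le f(u)\le Lu$ and $|f'(u)|\le L$ for all $u\ge 0$. The initial function satisfies $u_0\in C^2([-h_0,h_0])$, $u_0(-h_0)=u_0(h_0)=0$, and $u_0(x)>0$ for $-h_0<x<h_0$; put $\tilde w_0(\tilde z)=u_0((2\tilde z-1)h_0)$ for $0\le\tilde z\le1$, so that $\tilde w_0\in C^2([0,1])$, $\tilde w_0(0)=\tilde w_0(1)=0$ and $\tilde w_0>0$ on $(0,1)$. Mesh: $M\ge2$ and $N\ge1$ are integers, $\Delta\tilde z=1/M$, $\Delta t=T/N$, $\tilde z_j=j\Delta\tilde z$ for $0\le j\le M$. Difference operators: $\delta_t U_j^n=\frac{U_j^n-U_j^{n-1}}{\Delta t}$, $\delta_t Q^n=\frac{Q^n-Q^{n-1}}{\Delta t}$, $\delta_{\tilde z} U_{j+\frac12}^n=\frac{U_{j+1}^n-U_j^n}{\Delta\tilde z}$ for $0\le j\le M-1$, and $\delta_{\tilde z}^2U_j^n=\frac1{\Delta\tilde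 z}\bigl(\delta_{\tilde z}U_{j+\frac12}^n-\delta_{\tilde z}U_{j-\frac12}^n\bigr)$ for $1\le j\le M-1$. Scheme (S2) (a discretization of the double free boundary problem $u_t=du_{xx}+f(u)$ on $g(t)<x<h(t)$, $u(t,g(t))=u(t,h(t))=0$, $g'(t)=-\mu_1u_x(t,g(t))$, $h'(t)=-\mu_2u_x(t,h(t))$, $g(0)=-h_0$, $h(0)=h_0$, $u(0,x)=u_0(x)$, after the change of variables $\tilde z=\frac{x-g(t)}{h(t)-g(t)}$, $\tilde w(t,\tilde z)=u(t,x)$; $\tilde W_j^n,G^n,H^n$ approximate $\tilde w(t_n,\tilde z_j),g(t_n),h(t_n)$ with $t_n=n\Delta t$): the initial values are $G^0=-h_0$, $H^0=h_0$, $\tilde W_j^0=\tilde w_0(\tilde z_j)$, $0\le j\le M$, and for $1\le n\le N$ $$\delta_t\tilde W_j^n-\frac{(1-\tilde z_j)\,\delta_tG^n}{H^n-G^n}\,\delta_{\tilde z}\tilde W_{j-\frac12}^n-\frac{\tilde z_j\,\delta_tH^n}{H^n-G^n}\,\delta_{\tilde z}\tilde W_{j+\frac12}^n-\frac{d}{(H^n-G^n)^2}\,\delta_{\tilde z}^2\tilde W_j^n=f(\tilde W_j^{n-1}),\quad 1\le j\le M-1,$$ $$\tilde W_0^n=0,\qquad \tilde W_M^n=0,$$ $$\delta_tG^n=-\frac{\mu_1}{H^{n-1}-G^{n-1}}\,\delta_{\tilde z}\tilde W_{\frac12}^{n-1},\qquad \delta_tH^n=-\frac{\mu_2}{H^{n-1}-G^{n-1}}\,\delta_{\tilde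 z}\tilde W_{M-\frac12}^{n-1}.$$ Norm: on $V_2=\{(v_j)_{0\le j\le M}: v_0=0,\ v_M=0\}$, $(u,v)_d=\Delta\tilde z\sum_{j=1}^{M-1}u_jv_j$ and $\|u\|_d=\sqrt{(u,u)_d}$ (the subscript $d$ is only a label, not the diffusion constant). $\tilde W^n$ denotes $(\tilde W_j^n)_{0\le j\le M}$. *)

(* Defs.v *)
From Stdlib Require Import Reals.
From Coquelicot Require Import Coquelicot.
Open Scope R_scope.

(* C^2 on the closed interval [a, b]: [D_in] and [continue_in] are relative to
   the interval, so derivatives are one-sided at the end points and values of u
   outside [a, b] are irrelevant. *)
Definition C2_on (a b : R) (u : R -> R) : Prop :=
  exists u1 u2 : R -> R, forall x : R, a <= x <= b ->
    D_in u u1 (fun y => a <= y <= b) x /\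
    D_in u1 u2 (fun y => a <= y <= b) x /\
    continue_in u2 (fun y => a <= y <= b) x.

Definition reaction_term (L : R) (f : R -> R) : Prop :=
  (forall u : R, ex_derive f u) /\
  (forall u : R, 0 <= u -> - (L * u) <= f u <= L * u) /\
  (forall u : R, 0 <= u -> Rabs (Derive f u) <= L).

Definition initial_function (h0 : R) (u0 : R -> R) : Prop :=
  C2_on (- h0) h0 u0 /\ u0 (- h0) = 0 /\ u0 h0 = 0 /\
  (forall x : R, - h0 < x < h0 -> 0 < u0 x).

Definition w0_tilde (h0 : R) (u0 : R -> R) (z : R) : R := u0 ((2 * z - 1) * h0).

(* Backward difference; only used at n >= 1. *)
Definition delta_t (dt : R) (Q : nat -> R) (n : nat) : R :=
  (Q n - Q (n - 1)%nat) / dt.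

(* [delta_z dz U j] is the difference quotient at j + 1/2, hence the one at
   j - 1/2 is [delta_z dz U (j - 1)]. *)
Definition delta_z (dz : R) (U : nat -> R) (j : nat) : R :=
  (U (j + 1)%nat - U j) / dz.

(* Only used at j >= 1. *)
Definition delta_z2 (dz : R) (U : nat -> R) (j : nat) : R :=
  (delta_z dz U j - delta_z dz U (j - 1)%nat) / dz.

(* [W n j] stands for W_j^n; entries with n > N or j > M are unconstrained. *)
Record S2_solution (d mu1 mu2 h0 T : R) (f u0 : R -> R) (M N : nat)
    (W : nat -> nat -> R) (G H : nat -> R) : Prop := {
  S2_G0 : G 0%nat = - h0;
  S2_H0 : H 0%nat = h0;
  S2_W0 : forall j : nat, (j <= M)%nat ->
    W 0%nat j = w0_tilde h0 u0 (INR j * (1 / INR M));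
  S2_interior : forall n j : nat, (1 <= n <= N)%nat -> (1 <= j <= M - 1)%nat ->
    let dz := 1 / INR M in
    let dt := T / INR N in
    let z := INR j * dz in
    delta_t dt (fun k => W k j) n
    - (1 - z) * delta_t dt G n / (H n - G n) * delta_z dz (W n) (j - 1)
    - z * delta_t dt H n / (H n - G n) * delta_z dz (W n) j
    - d / (H n - G n) ^ 2 * delta_z2 dz (W n) j
    = f (W (n - 1)%nat j);
  S2_left : forall n : nat, (1 <= n <= N)%nat -> W n 0%nat = 0;
  S2_right : forall n : nat, (1 <= n <= N)%nat -> W n M = 0;
  S2_G : forall n : nat, (1 <= n <= N)%nat ->
    delta_t (T / INR N) G n
    = - (mu1 / (H (n - 1)%nat - G (n - 1)%nat)
         * delta_z (1 / INR M) (W (n - 1)%nat) 0);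
  S2_H : forall n : nat, (1 <= n <= N)%nat ->
    delta_t (T / INR N) H n
    = - (mu2 / (H (n - 1)%nat - G (n - 1)%nat)
         * delta_z (1 / INR M) (W (n - 1)%nat) (M - 1))
}.

Definition inner_d (M : nat) (u v : nat -> R) : R :=
  1 / INR M * sum_n_m (fun j => u j * v j) 1 (M - 1).

Definition norm_d (M : nat) (u : nat -> R) : R := sqrt (inner_d M u u).

(* Main.v *)
Require Import Defs.
From Stdlib Require Import Reals.
From Coquelicot Require Import Coquelicot.
From Stdlib Require Import Lra Lia.
Open Scope R_scope.

(** One step of the scheme solves [upwind M a b c (W n) j = W_j + dt f(W_j)],
    the right-hand side being taken at the old time level.  Here [upwind] is
    the identity plus transport plus diffusion, with nonnegative coefficients:
    a nonnegative old profile vanishing at both ends makes the left front move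
    left and the right front move right, so that the domain grows and each
    one-sided difference in the scheme is taken on the upwind side.

    Two consequences of this sign structure carry the proof.  The first is a
    discrete minimum principle ([upwind_nonneg]): since [L dt < 1], the
    right-hand side [W + dt f(W)] is nonnegative, hence so is the new profile,
    and nonnegativity propagates together with the growth of the domain
    ([step_nonneg]).  The second is an energy inequality ([upwind_energy]):
    testing against the solution, [|x|^2 <= (upwind x, x)].  The diffusion is
    dissipative, and so is the transport: in the coordinate rescaled to the
    unit interval its velocity is affine, nonnegative at 0 and nonpositive at
    1, because the domain grows.  Being nonincreasing, it contributes after
    summation by parts a nonnegative multiple of [|x|^2], however fast the
    fronts move.  This is why the constant does not depend on any bound on the
    front speeds.

    As [W + dt f(W) <= (1 + L dt) W] for [W >= 0], each step multiplies the
    norm by at most [1 + L dt <= exp (L dt)] ([step_norm]), and [n <= N] steps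
    by at most [exp (L T)]. *)

(** * The implicit upwind operator *)

(** The time step, the mesh width and the domain width are absorbed in the
    coefficients: [a] and [b] are the scaled speeds of the left and the right
    front, [c] is the scaled diffusion constant. *)
Definition upwind (M : nat) (a b c : R) (x : nat -> R) (j : nat) : R :=
  let z := INR j * (1 / INR M) in
  x j + a * (1 - z) * (x j - x (j - 1)%nat) - b * z * (x (j + 1)%nat - x j)
  - c * (x (j + 1)%nat - 2 * x j + x (j - 1)%nat).

Lemma grid_point_bounds (M j : nat) :
  (1 <= M)%nat -> (j <= M)%nat -> 0 <= INR j * (1 / INR M) <= 1.
Proof.
  intros hM hj.
  assert (hMp : 0 < INR M) by (apply lt_0_INR; lia).
  assert (h0j : 0 <= INR j) by apply pos_INR.
  apply le_INR in hj.
  split.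
  - apply Rmult_le_pos; [assumption | apply Rlt_le, Rdiv_lt_0_compat; lra].
  - replace (INR j * (1 / INR M)) with (INR j / INR M) by (field; lra).
    apply Rmult_le_reg_r with (INR M); [assumption |].
    field_simplify; lra.
Qed.

Lemma argmin_exists (x : nat -> R) (M : nat) :
  exists k, (k <= M)%nat /\ forall j, (j <= M)%nat -> x k <= x j.
Proof.
  induction M as [| M [k [hk hmin]]].
  - exists 0%nat. split; [lia |].
    intros j hj. replace j with 0%nat by lia. apply Rle_refl.
  - destruct (Rle_dec (x k) (x (S M))) as [hle | hgt].
    + exists k. split; [lia |]. intros j hj.
      destruct (Nat.eq_dec j (S M)) as [-> |]; [assumption | apply hmin; lia].
    + exists (S M). split; [lia |]. intros j hj.
      destruct (Nat.eq_dec j (S M)) as [-> |]; [apply Rle_refl |].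
      apply Rle_trans with (x k); [lra | apply hmin; lia].
Qed.

(** Discrete minimum principle: at an interior minimum every transport and
    diffusion contribution is nonpositive, so the value there is at least
    [upwind M a b c x j >= 0]. *)
Lemma upwind_nonneg (M : nat) (a b c : R) (x : nat -> R) :
  (1 <= M)%nat -> 0 <= a -> 0 <= b -> 0 <= c -> x 0%nat = 0 -> x M = 0 ->
  (forall j, (1 <= j <= M - 1)%nat -> 0 <= upwind M a b c x j) ->
  forall j, (j <= M)%nat -> 0 <= x j.
Proof.
  intros hM ha hb hc hx0 hxM hup j hj.
  destruct (argmin_exists x M) as [k [hk hmin]].
  apply Rle_trans with (x k); [| apply hmin, hj].
  destruct (Nat.eq_dec k 0) as [-> |]; [lra |].
  destruct (Nat.eq_dec k M) as [-> |]; [lra |].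
  specialize (hup k ltac:(lia)). unfold upwind in hup.
  destruct (grid_point_bounds M k hM hk) as [hz0 hz1].
  set (z := INR k * (1 / INR M)) in *. clearbody z.
  assert (hl : x k <= x (k - 1)%nat) by (apply hmin; lia).
  assert (hr : x k <= x (k + 1)%nat) by (apply hmin; lia).
  assert (0 <= a * (1 - z) * (x (k - 1)%nat - x k))
    by (repeat apply Rmult_le_pos; lra).
  assert (0 <= b * z * (x (k + 1)%nat - x k))
    by (repeat apply Rmult_le_pos; lra).
  assert (0 <= c * (x (k + 1)%nat - 2 * x k + x (k - 1)%nat))
    by (apply Rmult_le_pos; lra).
  lra.
Qed.

Lemma sum_le_telescope (F Phi : nat -> R) (m n : nat) :
  (m <= n)%nat ->
  (forall j, (m <= j <= n)%nat -> F j <= Phi (j + 1)%nat - Phi j) ->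
  sum_n_m F m n <= Phi (n + 1)%nat - Phi m.
Proof.
  intros hmn. induction hmn as [| n hmn IH]; intros hF.
  - rewrite sum_n_n. apply hF; lia.
  - rewrite sum_n_Sm by lia.
    assert (hlast := hF (S n) ltac:(lia)).
    assert (hinit := IH ltac:(intros j hj; apply hF; lia)).
    replace (n + 1)%nat with (S n) in hinit by lia.
    change (sum_n_m F m n + F (S n) <= Phi (S n + 1)%nat - Phi m). lra.
Qed.

(** Energy estimate, tested against a pointwise upper bound [y] for
    [upwind M a b c x].  Replacing each product of neighbouring values by half
    the sum of their squares makes the transport and diffusion terms telescope,
    up to terms of the favourable sign; the boundary values of the potential
    [Phi] contribute only [-c/2 (x_1^2 + x_{M-1}^2)].  The last step absorbs
    [(y, x) <= (|y|^2 + |x|^2) / 2]. *)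
Lemma upwind_energy (M : nat) (a b c : R) (x y : nat -> R) :
  (2 <= M)%nat -> 0 <= a -> 0 <= b -> 0 <= c -> x 0%nat = 0 -> x M = 0 ->
  (forall j, (1 <= j <= M - 1)%nat -> 0 <= x j) ->
  (forall j, (1 <= j <= M - 1)%nat -> upwind M a b c x j <= y j) ->
  inner_d M x x <= inner_d M y y.
Proof.
  intros hM ha hb hc hx0 hxM hx hup.
  assert (hMp : 0 < INR M) by (apply lt_0_INR; lia).
  set (e := 1 / INR M).
  assert (he : 0 < e) by (apply Rdiv_lt_0_compat; lra).
  (* Flux through the cell face between [j - 1] and [j]; the weight
     [INR j * e - e] is the coordinate of the grid point [j - 1]. *)
  pose (Phi := fun j =>
    / 2 * (b * (INR j * e - e) * (x j * x j)
           - a * (1 - INR j * e) * (x (j - 1)%nat * x (j - 1)%nat)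
           + c * (x j * x j - x (j - 1)%nat * x (j - 1)%nat))).
  assert (hsum : sum_n_m (fun j => / 2 * (x j * x j) + - / 2 * (y j * y j))
                   1 (M - 1) <= Phi (M - 1 + 1)%nat - Phi 1%nat).
  { apply sum_le_telescope; [lia |]. intros j hj.
    specialize (hup j hj). specialize (hx j hj).
    unfold upwind in hup. fold e in hup. unfold Phi.
    replace (j + 1 - 1)%nat with j by lia.
    rewrite plus_INR. simpl (INR 1).
    assert (hz := grid_point_bounds M j ltac:(lia) ltac:(lia)).
    fold e in hz.
    set (z := INR j * e) in *.
    replace ((INR j + 1) * e) with (z + e) by (unfold z; ring).
    clearbody z e.
    set (l := x (j - 1)%nat) in *. set (r := x (j + 1)%nat) in *.
    set (m := x j) in *.
    (* Together with [hsq], this is [m * upwind <= (m^2 + y_j^2) / 2]. *)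
    assert (hyx : 0 <= m * (y j - (m + a * (1 - z) * (m - l)
                     - b * z * (r - m) - c * (r - 2 * m + l))))
      by (apply Rmult_le_pos; lra).
    assert (hsq := Rle_0_sqr (y j - m)).
    assert (ha1 : 0 <= a * (1 - z) * Rsqr (m - l))
      by (apply Rmult_le_pos; [apply Rmult_le_pos; lra | apply Rle_0_sqr]).
    assert (ha2 : 0 <= a * e * Rsqr m)
      by (apply Rmult_le_pos; [apply Rmult_le_pos; lra | apply Rle_0_sqr]).
    assert (hb1 : 0 <= b * z * Rsqr (r - m))
      by (apply Rmult_le_pos; [apply Rmult_le_pos; lra | apply Rle_0_sqr]).
    assert (hb2 : 0 <= b * e * Rsqr m)
      by (apply Rmult_le_pos; [apply Rmult_le_pos; lra | apply Rle_0_sqr]).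
    assert (hc1 : 0 <= c * (Rsqr (m - l) + Rsqr (r - m)))
      by (apply Rmult_le_pos; [lra |];
          apply Rplus_le_le_0_compat; apply Rle_0_sqr).
    unfold Rsqr in *. lra. }
  assert (hPhi : Phi (M - 1 + 1)%nat - Phi 1%nat <= 0).
  { unfold Phi. replace (M - 1 + 1)%nat with M by lia. simpl (1 - 1)%nat.
    rewrite hx0, hxM. simpl (INR 1).
    replace (INR M * e) with 1 by (unfold e; field; lra).
    assert (h1 := Rmult_le_pos c _ hc (Rle_0_sqr (x 1%nat))).
    assert (h2 := Rmult_le_pos c _ hc (Rle_0_sqr (x (M - 1)%nat))).
    unfold Rsqr in *. lra. }
  assert (hsplit : sum_n_m (fun j => / 2 * (x j * x j) + - / 2 * (y j * y j))
                     1 (M - 1)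
      = / 2 * sum_n_m (fun j => x j * x j) 1 (M - 1)
        + - / 2 * sum_n_m (fun j => y j * y j) 1 (M - 1)).
  { rewrite <- (sum_n_m_mult_l (K := R_Ring) (/ 2)).
    rewrite <- (sum_n_m_mult_l (K := R_Ring) (- / 2)).
    apply (sum_n_m_plus (G := R_AbelianGroup)). }
  unfold inner_d. fold e. apply Rmult_le_compat_l; lra.
Qed.

Lemma inner_d_scal (M : nat) (q : R) (y : nat -> R) :
  inner_d M (fun j => q * y j) (fun j => q * y j) = q ^ 2 * inner_d M y y.
Proof.
  unfold inner_d.
  rewrite (sum_n_m_ext _ (fun j => mult (q ^ 2 : R_Ring) (y j * y j))).
  - rewrite (sum_n_m_mult_l (K := R_Ring)).
    change (@mult R_Ring) with Rmult.
    change (Ring.AbelianMonoid R_Ring) with R_AbelianMonoid. ring.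
  - intros j. change (q * y j * (q * y j) = q ^ 2 * (y j * y j)). ring.
Qed.

(** * Propagation along the scheme *)

(** The invariant of the induction on time: exactly what makes the next step
    an instance of [upwind] with nonnegative coefficients and data. *)
Record nonneg_state (M : nat) (W : nat -> nat -> R) (G H : nat -> R) (n : nat)
    : Prop := {
  ns_width : 0 < H n - G n;
  ns_left : W n 0%nat = 0;
  ns_right : W n M = 0;
  ns_nonneg : forall j, (j <= M)%nat -> 0 <= W n j
}.

(** The lower bound feeds the minimum principle, the upper bound the energy
    inequality. *)
Lemma reaction_step_bounds (L dt : R) (f : R -> R) (u : R) :
  reaction_term L f -> 0 <= dt -> L * dt <= 1 -> 0 <= u ->
  0 <= u + dt * f u <= (1 + L * dt) * u.
Proof.
  intros [_ [hf _]] hdt hLdt hu.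
  destruct (hf u hu) as [hlow hhigh].
  assert (h1 := Rmult_le_pos dt (f u + L * u) hdt ltac:(lra)).
  assert (h2 := Rmult_le_pos dt (L * u - f u) hdt ltac:(lra)).
  assert (h3 := Rmult_le_pos (1 - L * dt) u ltac:(lra) hu).
  split; lra.
Qed.

Section Scheme.

Variables (d mu1 mu2 h0 T L : R) (f u0 : R -> R) (M N : nat)
  (W : nat -> nat -> R) (G H : nat -> R).
Hypotheses (hd : 0 < d) (hmu1 : 0 < mu1) (hmu2 : 0 < mu2) (hh0 : 0 < h0)
  (hT : 0 < T) (hL : 0 < L) (hf : reaction_term L f)
  (hu0 : initial_function h0 u0) (hM : (2 <= M)%nat) (hN : (1 <= N)%nat)
  (hdtL : L * (T / INR N) <= 1)
  (hS : S2_solution d mu1 mu2 h0 T f u0 M N W G H).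

Let time_step_pos : 0 < T / INR N.
Proof. apply Rdiv_lt_0_compat; [assumption | apply lt_0_INR; lia]. Qed.

Let mesh_pos : 0 < 1 / INR M.
Proof. apply Rdiv_lt_0_compat; [lra | apply lt_0_INR; lia]. Qed.

Lemma initial_nonneg_state : nonneg_state M W G H 0.
Proof.
  destruct hu0 as [_ [hl [hr hpos]]].
  assert (hMp : 0 < INR M) by (apply lt_0_INR; lia).
  assert (hW0 : forall j, (j <= M)%nat ->
            W 0%nat j = u0 ((2 * (INR j * (1 / INR M)) - 1) * h0)).
  { intros j hj. apply (S2_W0 _ _ _ _ _ _ _ _ _ _ _ _ hS j hj). }
  split.
  - rewrite (S2_G0 _ _ _ _ _ _ _ _ _ _ _ _ hS),
      (S2_H0 _ _ _ _ _ _ _ _ _ _ _ _ hS). lra.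
  - rewrite hW0 by lia. simpl (INR 0).
    replace ((2 * (0 * (1 / INR M)) - 1) * h0) with (- h0) by ring. exact hl.
  - rewrite hW0 by lia.
    replace ((2 * (INR M * (1 / INR M)) - 1) * h0) with h0 by (field; lra).
    exact hr.
  - intros j hj. rewrite hW0 by assumption.
    destruct (grid_point_bounds M j ltac:(lia) hj) as [hz0 hz1].
    set (z := INR j * (1 / INR M)) in *.
    destruct (Req_dec z 0) as [-> |];
      [replace ((2 * 0 - 1) * h0) with (- h0) by ring; lra |].
    destruct (Req_dec z 1) as [-> |];
      [replace ((2 * 1 - 1) * h0) with h0 by ring; lra |].
    apply Rlt_le, hpos.
    assert (0 < z * h0) by (apply Rmult_lt_0_compat; lra).
    assert (0 < (1 - z) * h0) by (apply Rmult_lt_0_compat; lra).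
    lra.
Qed.

(** The Stefan conditions: a nonnegative profile vanishing at an end has an
    inward slope there, which pushes the front outward. *)
Lemma fronts_advance (n : nat) :
  (n < N)%nat -> nonneg_state M W G H n ->
  delta_t (T / INR N) G (S n) <= 0 /\ 0 <= delta_t (T / INR N) H (S n).
Proof.
  intros hn [hw hl hr hpos].
  rewrite (S2_G _ _ _ _ _ _ _ _ _ _ _ _ hS), (S2_H _ _ _ _ _ _ _ _ _ _ _ _ hS)
    by lia.
  replace (S n - 1)%nat with n by lia.
  unfold delta_z. simpl (0 + 1)%nat. replace (M - 1 + 1)%nat with M by lia.
  rewrite hl, hr.
  assert (h1 := hpos 1%nat ltac:(lia)).
  assert (h2 := hpos (M - 1)%nat ltac:(lia)).
  assert (hi := Rinv_0_lt_compat _ hw).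
  assert (hz := Rinv_0_lt_compat _ mesh_pos).
  assert (k1 : 0 <= mu1 * / (H n - G n) * (W n 1%nat * / (1 / INR M)))
    by (repeat apply Rmult_le_pos; lra).
  assert (k2 : 0 <= mu2 * / (H n - G n) * (W n (M - 1)%nat * / (1 / INR M)))
    by (repeat apply Rmult_le_pos; lra).
  unfold Rdiv in *. split; lra.
Qed.

Lemma width_grows (n : nat) :
  (n < N)%nat -> nonneg_state M W G H n -> 0 < H (S n) - G (S n).
Proof.
  intros hn hs. destruct (fronts_advance n hn hs) as [hG hH].
  destruct hs as [hw _ _ _].
  unfold delta_t in hG, hH. replace (S n - 1)%nat with n in hG, hH by lia.
  assert (G (S n) - G n <= 0).
  { replace (G (S n) - G n) with (T / INR N * ((G (S n) - G n) / (T / INR N)))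
      by (field; split; [apply not_0_INR; lia | lra]).
    assert (k := Rmult_le_pos (T / INR N) (- ((G (S n) - G n) / (T / INR N)))
                   ltac:(lra) ltac:(lra)).
    lra. }
  assert (0 <= H (S n) - H n).
  { replace (H (S n) - H n) with (T / INR N * ((H (S n) - H n) / (T / INR N)))
      by (field; split; [apply not_0_INR; lia | lra]).
    apply Rmult_le_pos; lra. }
  lra.
Qed.

(** Multiplying the scheme by the time step puts it in the form [upwind]; the
    advance of the fronts gives the signs of the coefficients. *)
Lemma step_upwind (n : nat) :
  (n < N)%nat -> nonneg_state M W G H n ->
  exists a b c : R, 0 <= a /\ 0 <= b /\ 0 <= c /\
    forall j, (1 <= j <= M - 1)%nat ->
      upwind M a b c (W (S n)) j = W n j + T / INR N * f (W n j).
Proof.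
  intros hn hs.
  destruct (fronts_advance n hn hs) as [hG hH].
  assert (hw := width_grows n hn hs).
  assert (hwi := Rinv_0_lt_compat _ hw).
  assert (hz := Rinv_0_lt_compat _ mesh_pos).
  set (dt := T / INR N) in *. set (dz := 1 / INR M) in *.
  set (w := H (S n) - G (S n)) in *.
  exists (dt * (- delta_t dt G (S n) * / w) * / dz),
    (dt * (delta_t dt H (S n) * / w) * / dz),
    (dt * (d * (/ w * / w)) * (/ dz * / dz)).
  split; [repeat first [lra | apply Rmult_le_pos] |].
  split; [repeat first [lra | apply Rmult_le_pos] |].
  split; [repeat first [lra | apply Rmult_le_pos] |].
  intros j hj.
  assert (hstep := S2_interior _ _ _ _ _ _ _ _ _ _ _ _ hS (S n) j
                     ltac:(lia) hj).
  cbv zeta in hstep. fold dt dz w in hstep.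
  replace (S n - 1)%nat with n in hstep by lia.
  rewrite <- hstep. unfold upwind. fold dz.
  unfold delta_z2, delta_z. replace (j - 1 + 1)%nat with j by lia.
  (* The front speeds stay abstract; only the time difference of [W] is
     expanded. *)
  set (gt := delta_t dt G (S n)). set (ht := delta_t dt H (S n)).
  unfold delta_t. replace (S n - 1)%nat with n by lia.
  field. repeat split; lra.
Qed.

Lemma step_nonneg (n : nat) :
  (n < N)%nat -> nonneg_state M W G H n -> nonneg_state M W G H (S n).
Proof.
  intros hn hs.
  destruct (step_upwind n hn hs) as [a [b [c [ha [hb [hc hup]]]]]].
  assert (hl := S2_left _ _ _ _ _ _ _ _ _ _ _ _ hS (S n) ltac:(lia)).
  assert (hr := S2_right _ _ _ _ _ _ _ _ _ _ _ _ hS (S n) ltac:(lia)).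
  split; [apply width_grows; assumption | assumption | assumption |].
  apply upwind_nonneg with a b c; try assumption; [lia |].
  intros j hj. rewrite hup by assumption.
  destruct hs as [_ _ _ hpos].
  apply (reaction_step_bounds L); [assumption | lra | assumption |].
  apply hpos; lia.
Qed.

Lemma nonneg_all (n : nat) : (n <= N)%nat -> nonneg_state M W G H n.
Proof.
  induction n as [| n IH]; intros hn; [apply initial_nonneg_state |].
  apply step_nonneg; [lia | apply IH; lia].
Qed.

(** The energy inequality with [y = (1 + L dt) W^n]; comparing [upwind] with
    this [y] pointwise is enough because both profiles are nonnegative. *)
Lemma step_norm (n : nat) :
  (n < N)%nat ->
  norm_d M (W (S n)) <= (1 + L * (T / INR N)) * norm_d M (W n).
Proof.
  intros hn.
  assert (hs := nonneg_all n ltac:(lia)).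
  assert (hs' := nonneg_all (S n) ltac:(lia)).
  destruct (step_upwind n hn hs) as [a [b [c [ha [hb [hc hup]]]]]].
  assert (hq : 0 < 1 + L * (T / INR N))
    by (assert (k := Rmult_lt_0_compat _ _ hL time_step_pos); lra).
  set (q := 1 + L * (T / INR N)) in *.
  unfold norm_d. rewrite <- (sqrt_pow2 q) at 1 by lra.
  rewrite <- sqrt_mult_alt by apply pow2_ge_0.
  apply sqrt_le_1_alt. rewrite <- inner_d_scal.
  destruct hs as [_ _ _ hpos]. destruct hs' as [_ hl' hr' hpos'].
  apply upwind_energy with a b c; try assumption.
  - intros j hj. apply hpos'; lia.
  - intros j hj. rewrite hup by assumption.
    apply (reaction_step_bounds L); [assumption | lra | assumption |].
    apply hpos; lia.
Qed.

Lemma norm_growth (n : nat) :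
  (n <= N)%nat ->
  norm_d M (W n) <= exp (L * (T / INR N) * INR n) * norm_d M (W 0%nat).
Proof.
  induction n as [| n IH]; intros hn.
  - simpl (INR 0). rewrite Rmult_0_r, exp_0. lra.
  - apply Rle_trans with (1 := step_norm n ltac:(lia)).
    rewrite S_INR.
    replace (L * (T / INR N) * (INR n + 1))
      with (L * (T / INR N) + L * (T / INR N) * INR n) by ring.
    rewrite exp_plus, Rmult_assoc.
    assert (k := Rmult_lt_0_compat _ _ hL time_step_pos).
    apply Rmult_le_compat; [lra | apply sqrt_pos | apply exp_ineq1_le |].
    apply IH; lia.
Qed.

End Scheme.

(** * Stability of the scheme *)

Theorem theorem3p5 (d mu1 mu2 h0 T L : R) (f u0 : R -> R)
    (hd : 0 < d) (hmu1 : 0 < mu1) (hmu2 : 0 < mu2) (hh0 : 0 < h0)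
    (hT : 0 < T) (hL : 0 < L)
    (hf : reaction_term L f) (hu0 : initial_function h0 u0) :
  exists C : R, 0 < C /\
    forall M N : nat, (2 <= M)%nat -> (1 <= N)%nat ->
      T / INR N < 1 / (2 * L) ->
      forall (W : nat -> nat -> R) (G H : nat -> R),
        S2_solution d mu1 mu2 h0 T f u0 M N W G H ->
        forall n : nat, (1 <= n <= N)%nat ->
          norm_d M (W n) <= C * norm_d M (W 0%nat).
Proof.
  exists (exp (L * T)). split; [apply exp_pos |].
  intros M N hM hN hdt W G H hS n hn.
  assert (hNp : 0 < INR N) by (apply lt_0_INR; lia).
  assert (hdtL : L * (T / INR N) <= 1).
  { apply (Rmult_lt_compat_l L) in hdt; [| assumption].
    replace (L * (1 / (2 * L))) with (/ 2) in hdt by (field; lra). lra. }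
  assert (hgrow := norm_growth d mu1 mu2 h0 T L f u0 M N W G H
    hd hmu1 hmu2 hh0 hT hL hf hu0 hM hN hdtL hS n ltac:(lia)).
  apply Rle_trans with (1 := hgrow).
  apply Rmult_le_compat_r; [apply sqrt_pos |].
  assert (htime : L * (T / INR N) * INR n <= L * T).
  { replace (L * T) with (L * (T / INR N) * INR N) by (field; lra).
    apply Rmult_le_compat_l; [| apply le_INR; lia].
    apply Rlt_le, Rmult_lt_0_compat;
      [| apply Rdiv_lt_0_compat]; assumption. }
  destruct htime as [hlt | ->]; [| apply Rle_refl].
  apply Rlt_le, exp_increasing, hlt.
Qed.
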